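(* Let $P$ be the probability measure on $\{1,2,3,4,5,6\}\subset\mathbb{R}$ with probability mass function $f(j)=\left(\frac{3}{10}\right)^{j-1}\frac{7}{10}$ for $j\in\{1,2,3,4,5\}$ and $f(6)=\left(\frac{3}{10}\right)^{5}$. The optimal set of three-means for $P$ is $\{1,2,a[3,6]\}$, with quantization error $V_3(P)=\frac{4779999}{100000000}$.
   Context: For a Borel probability measure $P$ on $\mathbb{R}$ and a nonempty finite set $\alpha\subset\mathbb{R}$, the distortion error is $V(P;\alpha)=\int\min_{a\in\alpha}|x-a|^2\,dP(x)$. The $n$th quantization error is $V_n(P)=\inf\{V(P;\alpha):\alpha\subset\mathbb{R},\ 1\le\mathrm{card}(\alpha)\le n\}$, and a set $\alpha$ with $1\le\mathrm{card}(\alpha)\le n$ attaining this infimum is called an optimal set of $n$-means for $P$. For $i\le j$ in $\{1,\dots,6\}$, $a[i,j]=\dfrac{\sum_{k=i}^{j}k f(k)}{\sum_{k=i}^{j}f(k)}$. *)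

(* Defs.v *)
From HB Require Import structures.
From mathcomp Require Import all_boot all_order all_algebra finmap.
From mathcomp Require Import all_classical all_reals all_analysis.
From mathcomp Require Import ring lra.

Set Implicit Arguments.
Unset Strict Implicit.
Unset Printing Implicit Defensive.

Import Order.TTheory GRing.Theory Num.Theory.
Import numFieldNormedType.Exports.

Local Open Scope classical_set_scope.
Local Open Scope ring_scope.

Section quantization.
Context {R : realType}.
Implicit Types (P : probability (measurableTypeR R) R) (alpha : {fset R}).

(* The neutral element +oo only matters for the empty set, which card_range
   excludes below. *)
Definition sq_dist alpha (x : R) : \bar R :=
  \big[Order.min/+oo%E]_(a <- alpha) (`|x - a| ^+ 2)%:E.

Definition distortion P alpha : \bar R := (\int[P]_x sq_dist alpha x)%E.

Definition card_range (n : nat) : set {fset R} :=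
  [set alpha | (1 <= #|` alpha| <= n)%N].

Definition quantization_error (n : nat) P : \bar R :=
  ereal_inf [set distortion P alpha | alpha in card_range n].

Definition optimal_set (n : nat) P alpha : Prop :=
  card_range n alpha /\ distortion P alpha = quantization_error n P.

End quantization.

Section truncated_geometric.
Context {R : realType}.

Definition trunc_geom_pmf (j : nat) : R :=
  if (1 <= j <= 5)%N then (3 / 10) ^+ (j - 1) * (7 / 10)
  else if j == 6 then (3 / 10) ^+ 5
  else 0.

Lemma trunc_geom_pmf_ge0 (j : nat) : 0 <= trunc_geom_pmf j.
Proof.
have le03 : 0 <= 3 / 10 :> R by lra.
rewrite /trunc_geom_pmf; case: ifP => _; last first.
  by case: ifP => // _; exact: exprn_ge0.
by apply: mulr_ge0; [exact: exprn_ge0 | lra].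
Qed.

(* The index k : 'I_6 stands for the atom j = k + 1. *)
Definition trunc_geom : set (measurableTypeR R) -> \bar R :=
  msum (fun k : nat => mscale (NngNum (trunc_geom_pmf_ge0 k.+1))
    (dirac (k.+1%:R : measurableTypeR R))) 6.

HB.instance Definition _ := Measure.on trunc_geom.

Lemma trunc_geom_setT : trunc_geom setT = 1%E.
Proof.
rewrite /trunc_geom /msum !big_ord_recl big_ord0 /= /mscale /= !diracT.
rewrite !mule1 adde0 -!EFinD; congr (_%:E).
by rewrite /trunc_geom_pmf /= /bump /=; field.
Qed.

HB.instance Definition _ :=
  Measure_isProbability.Build _ _ _ trunc_geom trunc_geom_setT.

Lemma trunc_geom_set1 (j : nat) :
  trunc_geom [set j%:R] = (trunc_geom_pmf j)%:E.
Proof.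
have dirac_nat (k : nat) :
    dirac (k%:R : measurableTypeR R) [set j%:R] = (k == j)%:R%:E :> \bar R.
  rewrite diracE; congr ((nat_of_bool _)%:R%:E).
  by apply/idP/eqP => [/set_mem/eqP|->];
    [rewrite eqr_nat => /eqP | exact/mem_set].
rewrite /trunc_geom /msum !big_ord_recl big_ord0 /= /mscale /= !dirac_nat.
case: j {dirac_nat} => [|[|[|[|[|[|[|j]]]]]]];
  by rewrite /= ?mule0 ?mule1 ?add0e ?adde0.
Qed.

Definition cond_mean (i j : nat) : R :=
  (\sum_(i <= k < j.+1) k%:R * trunc_geom_pmf k) /
  (\sum_(i <= k < j.+1) trunc_geom_pmf k).

End truncated_geometric.

Arguments trunc_geom : clear implicits.
Arguments cond_mean : clear implicits.

(* Main.v *)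
(** In a set of at most three points, consider the points [a 1], ..., [a 6]
serving the six atoms.  If one point serves both [i] and [j], the distortion is
at least [f i * f j / (f i + f j) * (i - j)^2].  These bounds force [a 1], [a 2]
and [a 3] to be distinct, hence to exhaust the set, and then force 4, 5 and 6 to
be served by [a 3].  The distortion is then a sum of three quadratics, whose
unique minimizers are the conditional means of the three blocks. *)
Require Import Defs.
From mathcomp Require Import all_boot all_order all_algebra finmap.
From mathcomp Require Import all_classical all_reals all_analysis.
From mathcomp Require Import measurable_realfun ring lra.

Import Order.TTheory GRing.Theory Num.Theory.

Local Open Scope fset_scope.
Local Open Scope ring_scope.

Section sq_dist.
Context {R : realType}.
Implicit Types (alpha : {fset R}) (x a : R).

Lemma sq_dist_le alpha x a :
  a \in alpha -> (sq_dist alpha x <= ((x - a) ^+ 2)%:E)%E.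
Proof.
rewrite -(@real_normK _ (x - a)) ?num_real// => aalpha.
exact: (ge_bigmin_seq _ a xpredT (fun a => (`|x - a| ^+ 2)%:E)).
Qed.

Lemma sq_dist_attained alpha x : (0 < #|` alpha|)%N ->
  exists2 a, a \in alpha & sq_dist alpha x = ((x - a) ^+ 2)%:E.
Proof.
have attained (s : seq R) : s != [::] -> exists2 a, a \in s &
    \big[Order.min/+oo%E]_(b <- s) (`|x - b| ^+ 2)%:E = ((x - a) ^+ 2)%:E.
  elim: s => // b s IHs _; rewrite big_cons real_normK ?num_real//.
  (* The induction really starts at singletons: the empty minimum [+oo] is attained at no point. *)
  have [->|/IHs[a sa ->]] := eqVneq s [::].
    by exists b; rewrite ?inE// big_nil miney.
  rewrite minEle; case: ifP => _; first by exists b; rewrite ?mem_head.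
  by exists a => //; rewrite inE sa orbT.
by rewrite lt0n size_eq0 => /attained.
Qed.

Lemma sq_dist_ge0 alpha x : (0 <= sq_dist alpha x)%E.
Proof.
rewrite /sq_dist; elim/big_ind: _ => //= u v u0 v0.
by rewrite le_min u0.
Qed.

Lemma measurable_sq_dist alpha :
  measurable_fun setT (sq_dist alpha : measurableTypeR R -> \bar R).
Proof.
rewrite /sq_dist; elim: (enum_fset alpha) => [|a s IHs].
  by under eq_fun do rewrite big_nil; exact: measurable_cst.
under eq_fun do rewrite big_cons.
apply: measurable_mine => //; apply/measurable_EFinP.
apply: measurable_funX; apply: measurableT_comp => //.
exact: measurable_funB.
Qed.

End sq_dist.

Section trunc_geom_distortion.
Context {R : realType}.
Implicit Types (alpha : {fset R}) (a : nat -> R).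

Lemma distortion_trunc_geom alpha : distortion (trunc_geom R) alpha =
  (\sum_(1 <= j < 7) (trunc_geom_pmf j)%:E * sq_dist alpha j%:R)%E.
Proof.
rewrite /distortion /= /trunc_geom ge0_integral_measure_sum//; last 2 first.
- by move=> x _; exact: sq_dist_ge0.
- exact: measurable_sq_dist.
rewrite big_add1 big_mkord; apply: eq_bigr => k _.
rewrite ge0_integral_mscale//; last 2 first.
- exact: measurable_sq_dist.
- by move=> x _; exact: sq_dist_ge0.
rewrite integral_dirac//; last exact: measurable_sq_dist.
by rewrite diracT mul1e.
Qed.

(** Here [a j] serves the atom [j], whether or not it is nearest. The distortion of a nonempty
    [alpha] is the minimum of this cost over assignments into [alpha], which turns the integral of a
    minimum into a real polynomial. *)
Definition assignment_cost a : R :=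
  \sum_(1 <= j < 7) trunc_geom_pmf j * (j%:R - a j) ^+ 2.

Lemma distortion_le_assignment_cost alpha a : (forall j, a j \in alpha) ->
  (distortion (trunc_geom R) alpha <= (assignment_cost a)%:E)%E.
Proof.
move=> aalpha; rewrite distortion_trunc_geom /assignment_cost -sumEFin.
apply: lee_sum => j _; rewrite EFinM lee_wpmul2l ?lee_fin//.
  exact: trunc_geom_pmf_ge0.
exact: sq_dist_le.
Qed.

Lemma distortion_attained alpha : (0 < #|` alpha|)%N ->
  exists2 a, (forall j, a j \in alpha) &
    distortion (trunc_geom R) alpha = (assignment_cost a)%:E.
Proof.
move=> alpha0; have near j := sq_dist_attained alpha (j%:R) alpha0.
exists (fun j => s2val (cid2 (near j))); first by move=> j; case: cid2.
rewrite distortion_trunc_geom /assignment_cost -sumEFin.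
by apply: eq_bigr => j _; case: cid2 => /= b _ ->.
Qed.

(** Horner form in the ratio 3/10 of consecutive masses; the last ratio is f(6)/f(5) = 3/7. *)
Lemma assignment_costE a : assignment_cost a =
  7 / 10 * ((1 - a 1%N) ^+ 2 + 3 / 10 * ((2 - a 2%N) ^+ 2
  + 3 / 10 * ((3 - a 3%N) ^+ 2 + 3 / 10 * ((4 - a 4%N) ^+ 2
  + 3 / 10 * ((5 - a 5%N) ^+ 2 + 3 / 7 * (6 - a 6%N) ^+ 2))))).
Proof.
rewrite /assignment_cost /index_iota [iota _ _]/= !big_cons big_nil.
rewrite /trunc_geom_pmf [LHS]/= !subSS !subn0.
by field.
Qed.

Definition optimal_cost : R := 4779999%N%:R / 100000000%N%:R.

(* Keeps the unary value of the large literals out of conversion problems. *)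
Lemma optimal_costE : optimal_cost = (478 - 1 / 10 ^+ 4) / 10 ^+ 4.
Proof. by rewrite /optimal_cost; lra. Qed.

Lemma cond_mean36 : cond_mean R 3 6 = 3417 / 1000.
Proof.
rewrite /cond_mean /index_iota /= !big_cons !big_nil
  /trunc_geom_pmf /= !subSS !subn0.
by field.
Qed.

(** The gap is the square of [p * (x - c) + q * (y - c)], zero when [c] is the weighted mean of [x]
    and [y]. *)
Lemma shared_center_cost (p q x y c : R) :
  p * q * (x - y) ^+ 2 <= (p + q) * (p * (x - c) ^+ 2 + q * (y - c) ^+ 2).
Proof.
rewrite -subr_ge0 (_ : _ - _ = (p * (x - c) + q * (y - c)) ^+ 2).
  exact: sqr_ge0.
by ring.
Qed.

(** Gives both optimality and uniqueness: a cost below [optimal_cost] would have to equal it, and a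
    cost equal to it determines the three points. *)
Lemma assignment_cost_rigid alpha a :
  (#|` alpha| <= 3)%N -> (forall j, a j \in alpha) ->
  assignment_cost a <= optimal_cost ->
  [/\ a 1%N = 1, a 2%N = 2, a 3%N = 3417 / 1000
    & assignment_cost a = optimal_cost].
Proof.
move=> alpha3 aalpha cost_le.
(* This threshold lies between [optimal_cost] and the least cost of serving 2 and 3 from one point,
   about 0.04846. *)
have cost_lt : assignment_cost a < 48 / 1000.
  by apply: le_lt_trans cost_le _; rewrite optimal_costE; lra.
move: cost_le cost_lt.
rewrite assignment_costE optimal_costE => cost_le cost_lt.
have s1 := sqr_ge0 (1 - a 1%N); have s2 := sqr_ge0 (2 - a 2%N).
have s3 := sqr_ge0 (3 - a 3%N); have s4 := sqr_ge0 (4 - a 4%N).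
have s5 := sqr_ge0 (5 - a 5%N); have s6 := sqr_ge0 (6 - a 6%N).
(* Weights [p] and [q] may be used whenever [q / p] is at most the ratio of the
   masses; that ratio is rounded down when there is room. *)
have shared := shared_center_cost.
have n12 : a 1%N != a 2%N.
  apply/eqP => e; rewrite -e in s2 cost_lt.
  by have := shared 10 3 1 2 (a 1%N); lra.
have n13 : a 1%N != a 3%N.
  apply/eqP => e; rewrite -e in s3 cost_lt.
  by have := shared 12 1 1 3 (a 1%N); lra.
have n23 : a 2%N != a 3%N.
  apply/eqP => e; rewrite -e in s3 cost_lt.
  by have := shared 10 3 2 3 (a 2%N); lra.
have alphaE : [fset a 1%N; a 2%N; a 3%N] = alpha.
  apply/eqP; rewrite eqEfcard; apply/andP; split.
    by apply/fsubsetP => x; rewrite !inE => /orP[/orP[]|] /eqP ->.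
  apply: leq_trans alpha3 _.
  by rewrite fsetUC cardfsU1 cardfs2 !inE ![a 3%N == _]eq_sym n12
    (negbTE n13) (negbTE n23).
have a_cases j : [\/ a j = a 1%N, a j = a 2%N | a j = a 3%N].
  have := aalpha j; rewrite -{1}alphaE !inE => /orP[/orP[]|] /eqP.
  - exact: Or31.
  - exact: Or32.
  - exact: Or33.
have e4 : a 4%N = a 3%N.
  case: (a_cases 4%N) => // e; rewrite e in s4 cost_lt.
    by have := shared 38 1 1 4 (a 1%N); lra.
  by have := shared 12 1 2 4 (a 2%N); lra.
rewrite e4 in s4 cost_le cost_lt *.
(* Serving 2 and 6 together forces a cost of only about 0.038; the 0.0145 forced by 3 and 4 sharing
   [a 3] lifts the total above the threshold. *)
have c34 := shared 10 3 3 4 (a 3%N).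
have e5 : a 5%N = a 3%N.
  case: (a_cases 5%N) => // e; rewrite e in s5 cost_lt.
    by have := shared 125 1 1 5 (a 1%N); lra.
  by have := shared 38 1 2 5 (a 2%N); lra.
rewrite e5 in s5 cost_le cost_lt *.
have e6 : a 6%N = a 3%N.
  case: (a_cases 6%N) => // e; rewrite e in s6 cost_lt.
    by have := shared 290 1 1 6 (a 1%N); lra.
  by have := shared 87 1 2 6 (a 2%N); lra.
rewrite e6 in s6 cost_le cost_lt *.
(* The cost is now [optimal_cost] plus positive multiples of this square and of those in [s1] and
   [s2], so all three squares vanish. *)
have sm := sqr_ge0 (a 3%N - 3417 / 1000).
have sq_eq (u v : R) : (u - v) ^+ 2 = 0 -> v = u.
  by move/eqP; rewrite sqrf_eq0 subr_eq0 => /eqP.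
have a1 : a 1%N = 1 by apply: sq_eq; lra.
have a2 : a 2%N = 2 by apply: sq_eq; lra.
have a3 : a 3%N = 3417 / 1000 by apply/esym/sq_eq; lra.
by split => //; rewrite a1 a2 a3; field.
Qed.

Lemma distortion_ge alpha : card_range 3 alpha ->
  (optimal_cost%:E <= distortion (trunc_geom R) alpha)%E.
Proof.
move=> /andP[alpha1 alpha3]; have [a aalpha ->] := distortion_attained _ alpha1.
rewrite lee_fin leNgt; apply/negP => cost_lt.
have [_ _ _ costE] := assignment_cost_rigid _ _ alpha3 aalpha (ltW cost_lt).
by rewrite costE ltxx in cost_lt.
Qed.

Lemma distortion_eq alpha : card_range 3 alpha ->
  distortion (trunc_geom R) alpha = optimal_cost%:E ->
  alpha = [fset 1; 2; cond_mean R 3 6].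
Proof.
move=> /andP[alpha1 alpha3]; have [a aalpha ->] := distortion_attained _ alpha1.
move=> [costE].
have cost_le : assignment_cost a <= optimal_cost by rewrite costE.
have [a1 a2 a3 _] := assignment_cost_rigid _ _ alpha3 aalpha cost_le.
apply/esym/eqP; rewrite eqEfcard; apply/andP; split.
  apply/fsubsetP => x; rewrite cond_mean36 !inE.
  by move=> /orP[/orP[]|] /eqP ->; [rewrite -a1 | rewrite -a2 | rewrite -a3].
apply: leq_trans alpha3 _; rewrite cond_mean36 fsetUC cardfsU1 cardfs2 !inE.
have -> : (3417 / 1000 == 1 :> R) = false by apply: gt_eqF; lra.
have -> : (3417 / 1000 == 2 :> R) = false by apply: gt_eqF; lra.
by have -> : (1 == 2 :> R) = false by apply: lt_eqF; lra.
Qed.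

Lemma card_range_optimum : card_range 3 [fset 1; 2; cond_mean R 3 6].
Proof.
rewrite /card_range /= cond_mean36 fsetUC cardfsU1 cardfs2.
(* The cardinality lies between 1 and 3 whichever of the points coincide. *)
by case: (_ \notin _); case: (_ != _).
Qed.

Lemma distortion_optimum :
  distortion (trunc_geom R) [fset 1; 2; cond_mean R 3 6] = optimal_cost%:E.
Proof.
apply/le_anti/andP; split; last exact: distortion_ge card_range_optimum.
(* The blocks are {1}, {2} and {3,...,6}; indices that are not atoms also go to the mean, so that
   every [a j] lies in the set. *)
pose a (j : nat) : R :=
  if j == 1%N then 1 else if j == 2%N then 2 else cond_mean R 3 6.
have -> : optimal_cost = assignment_cost a.
  by rewrite optimal_costE assignment_costE /a /= cond_mean36; field.
apply: distortion_le_assignment_cost => j.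
by rewrite /a; case: ifP => _; [|case: ifP => _]; rewrite !inE eqxx ?orbT.
Qed.

Lemma quantization_error_trunc_geom3 :
  quantization_error 3 (trunc_geom R) = optimal_cost%:E.
Proof.
apply/le_anti/andP; split.
  rewrite -distortion_optimum; apply: ereal_inf_lbound.
  by exists [fset 1; 2; cond_mean R 3 6] => //; exact: card_range_optimum.
by apply: le_ereal_inf_tmp => _ [alpha alpha3 <-]; exact: distortion_ge.
Qed.

End trunc_geom_distortion.

Theorem proposition3p8 (R : realType) :
  (forall alpha : {fset R},
     optimal_set 3 (trunc_geom R) alpha <->
     alpha = [fset 1; 2; cond_mean R 3 6]) /\
  quantization_error 3 (trunc_geom R) = (4779999%N%:R / 100000000%N%:R)%:E.
Proof.
split; last exact: quantization_error_trunc_geom3.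
move=> alpha; rewrite /optimal_set quantization_error_trunc_geom3; split.
  by move=> [alpha3]; exact: distortion_eq.
by move=> ->; split; [exact: card_range_optimum | exact: distortion_optimum].
Qed.
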